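(* For every integer $n\ge1$, the following algorithm outputs $B(n)$, the number of repeated squares (occurrences of squares) in $\mathbb{T}[1,n]$. Start with the vector $v=[0,0,0,0,0,0,0,1,0,1,0,0,0,1]$ of length $14$. If $n\le 14$, output the sum of the first $n$ entries of $v$. If $n\ge15$, let $M$ be the positive integer with $2t_{M-1}<n\le 2t_M$ (so $M\ge4$). For $m=4,5,\ldots,M$ successively, replace $v$ by the concatenation of $v$ with the three vectors $v_U,v_V,v_W$ (in this order), of lengths $t_{m-3},t_{m-2},t_{m-1}$, defined from the entries of the current $v$ by $$\begin{cases} v_U = v(\Theta_{m-3})+[\underbrace{1,\ldots,1}_{\frac{-t_{m-1}+5t_{m-3}+1}{2}},\underbrace{0,\ldots,0}_{\frac{t_{m-1}-3t_{m-3}-1}{2}}],\\[2mm] v_V = v(\Theta_{m-2})+[\underbrace{0,\ldots,0}_{\frac{t_{m-2}-t_{m-4}+1}{2}},\underbrace{1,\ldots,1}_{\frac{t_{m-2}+t_{m-4}-1}{2}}],\\[2mm] v_W = v(\Theta_{m-1})+[\underbrace{0,\ldots,0}_{\frac{t_{m-1}+t_{m-3}+1}{2}},\underbrace{1,\ldots,1}_{\frac{t_{m-1}-t_{m-3}-1}{2}}].\end{cases}$$ After the step $m=M$, output the sum of the first $n$ entries of $v$.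
   Context: The Tribonacci substitution $\sigma$ on the alphabet $\{a,b,c\}$ is $\sigma(a)=ab$, $\sigma(b)=ac$, $\sigma(c)=a$. The Tribonacci sequence $\mathbb{T}$ is the infinite word that is the fixed point of $\sigma$ beginning with $a$; $\mathbb{T}[1,n]$ is its prefix of length $n$. Put $T_{-2}=\epsilon$ (empty word), $T_{-1}=c$, $T_m=\sigma^m(a)$ for $m\ge0$, $t_m=|T_m|$ for $m\ge-2$, and $t_{-3}=0$; thus $t_{-3}=t_{-2}=0$, $t_{-1}=t_0=1$, $t_1=2$, $t_2=4$, $t_3=7$, $t_4=13$, and $t_m=t_{m-1}+t_{m-2}+t_{m-3}$ for $m\ge1$. For a non-empty factor $\omega$ of $\mathbb{T}$ and $p\ge1$, $\omega_p$ is the position in $\mathbb{T}$ of the last letter of the $p$-th occurrence of $\omega$. Write $\nu\triangleright\omega$ if $\nu$ is a suffix of $\omega$. Then $B(n)=\#\{(\omega,p)\mid \omega \text{ non-empty},\ p\ge1,\ \omega\omega\triangleright\mathbb{T}[1,\omega_{p+1}],\ \omega_{p+1}\le n\}$. For $m\ge0$, $\Theta_m$ is the interval of $t_m$ consecutive integers $\{i+\frac{t_{m+1}+t_{m-1}-3}{2} : 1\le i\le t_m\}$ (these intervals partition the positive integers: $\Theta_0=\{1\}$, $\Theta_1=\{2,3\}$, $\Theta_2=\{4,\dots,7\}$, $\Theta_3=\{8,\dots,14\}$, ...). For an interval $I=\{i,i+1,\ldots,j\}$, $v(I)=[v[i],v[i+1],\ldots,v[j]]$ where $v[k]$ is the $k$-th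 entry of $v$. Vectors of equal length are added entrywise; the number under a brace is the number of repeated entries. *)

(* Defs.v *)
From HB Require Import structures.
From mathcomp Require Import all_boot all_order all_algebra.
From mathcomp Require Import zify.
From mathcomp Require Export classical_sets cardinality.

Set Implicit Arguments.
Unset Strict Implicit.
Unset Printing Implicit Defensive.

Local Open Scope nat_scope.

Inductive letter := La | Lb | Lc.

Definition letter_eqb (x y : letter) : bool :=
  match x, y with
  | La, La | Lb, Lb | Lc, Lc => true
  | _, _ => false
  end.

Lemma letter_eqP : Equality.axiom letter_eqb.
Proof. by case; case; constructor. Qed.

HB.instance Definition _ := hasDecEq.Build letter letter_eqP.

Definition sigma1 (x : letter) : seq letter :=
  match x with
  | La => [:: La; Lb]
  | Lb => [:: La; Lc]
  | Lc => [:: La]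
  end.

Definition sigma (u : seq letter) : seq letter := flatten (map sigma1 u).

(* An infinite word is a function on nat; the letter at position k >= 1 of w
   is [w k.-1].  [pref w n] is w[1,n]. *)
Definition pref (w : nat -> letter) (n : nat) : seq letter := mkseq w n.

(* sigma(w) = w: the image of every finite prefix of w is a prefix of w. *)
Definition fixed_point (w : nat -> letter) : Prop :=
  forall n, sigma (pref w n) = pref w (size (sigma (pref w n))).

Definition is_tribonacci (w : nat -> letter) : Prop :=
  w 0 = La /\ fixed_point w.

Definition factor (w : nat -> letter) (om : seq letter) : Prop :=
  exists k, suffix om (pref w k).

(* For nonempty om: k is the position of the last letter of the p-th
   occurrence of om in w, i.e. k = om_p. *)
Definition is_occ_end (w : nat -> letter) (om : seq letter) (p k : nat) : Prop :=
  suffix om (pref w k) /\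
  count (fun j => suffix om (pref w j)) (iota 1 k) = p.

(* The set of pairs (om, p) counted by B(n). *)
Definition repeated_squares (w : nat -> letter) (n : nat) :
    set (seq letter * nat) :=
  [set x | [/\ x.1 <> [::], factor w x.1, 1 <= x.2
      & exists k, [/\ is_occ_end w x.1 x.2.+1 k,
                      suffix (x.1 ++ x.1) (pref w k) & k <= n]]]%classic.

(* The words T_m, for m >= -2 (with T_{-3} empty too, so that t_{-3} = 0). *)
Definition Tword (m : int) : seq letter :=
  match m with
  | Posz k => iter k sigma [:: La]
  | Negz 0 => [:: Lc]
  | Negz _ => [::]
  end.

Definition t (m : int) : nat := size (Tword m).

(* For m >= 0 the numerator is nonnegative and even: see [Theta_exact]. *)
Definition Theta (m : int) : seq nat :=
  [seq i + (t (m + 1)%R + t (m - 1)%R - 3)./2 | i <- iota 1 (t m)].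

(* v(I), with 1-based positions. *)
Definition restrict (v I : seq nat) : seq nat := [seq nth 0 v k.-1 | k <- I].

Definition vadd (u v : seq nat) : seq nat := [seq x.1 + x.2 | x <- zip u v].

(* In the three corrections the subtractions never truncate and the halves
   are exact whenever m >= 4: see [correction_exact]. *)
Definition step (v : seq nat) (m : int) : seq nat :=
  let t1 := t (m - 1)%R in
  let t2 := t (m - 2)%R in
  let t3 := t (m - 3)%R in
  let t4 := t (m - 4)%R in
  let vU := vadd (restrict v (Theta (m - 3)%R))
    (nseq (5 * t3 + 1 - t1)./2 1 ++ nseq (t1 - 3 * t3 - 1)./2 0) in
  let vV := vadd (restrict v (Theta (m - 2)%R))
    (nseq (t2 - t4 + 1)./2 0 ++ nseq (t2 + t4 - 1)./2 1) in
  let vW := vadd (restrict v (Theta (m - 1)%R))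
    (nseq (t1 + t3 + 1)./2 0 ++ nseq (t1 - t3 - 1)./2 1) in
  v ++ vU ++ vV ++ vW.

Definition v0 : seq nat := [:: 0; 0; 0; 0; 0; 0; 0; 1; 0; 1; 0; 0; 0; 1].

Definition vec (M : nat) : seq nat :=
  foldl (fun v m => step v (Posz m)) v0 (iota 4 (M - 3)).

Definition is_level (n M : nat) : bool :=
  (0 < M) && (2 * t (M%:Z - 1)%R < n <= 2 * t M%:Z).

(* The unique M with [is_level n M] when 15 <= n: see [levelP]. *)
Definition level (n : nat) : nat := find (is_level n) (iota 0 n).

Definition algorithm (n : nat) : nat :=
  if n <= 14 then sumn (take n v0) else sumn (take n (vec (level n))).

Lemma sigma_cat u v : sigma (u ++ v) = sigma u ++ sigma v.
Proof. by rewrite /sigma map_cat flatten_cat. Qed.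

Lemma iter_sigma_cat k u v :
  iter k sigma (u ++ v) = iter k sigma u ++ iter k sigma v.
Proof. by elim: k => //= k ->; rewrite sigma_cat. Qed.

Lemma Tword_rec (k : nat) :
  Tword k.+3 = Tword k.+2 ++ Tword k.+1 ++ Tword k.
Proof.
by rewrite /Tword !iterSr /sigma /= -!iter_sigma_cat.
Qed.

Lemma t_rec (k : nat) : t k.+3 = t k.+2 + t k.+1 + t k.
Proof. by rewrite /t Tword_rec !size_cat addnA. Qed.

Lemma t_bounds (k : nat) :
  [/\ 0 < t k, t k < t k.+1, t k + t k.+1 <= t k.+2 & t k.+2 <= 2 * t k.+1].
Proof.
elim: k => [|k [h1 h2 h3 h4]]; first by [].
by rewrite t_rec; split; lia.
Qed.

Lemma t_gt (k : nat) : k < t k.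
Proof. by elim: k => // k IH; have [? ? ? ?] := t_bounds k; lia. Qed.

Lemma t_mono (j k : nat) : j <= k -> t j <= t k.
Proof.
move=> /subnK <-; elim: (k - j) => // d IH.
by have [? ? ? ?] := t_bounds (d + j); rewrite addSn; lia.
Qed.

Lemma correction_exact (m : nat) : 4 <= m ->
  let t1 := t (m%:Z - 1)%R in
  let t2 := t (m%:Z - 2)%R in
  let t3 := t (m%:Z - 3)%R in
  let t4 := t (m%:Z - 4)%R in
  [/\ (5 * t3 + 1 - t1)./2.*2 + t1 = 5 * t3 + 1,
      (t1 - 3 * t3 - 1)./2.*2 + 3 * t3 + 1 = t1,
      (t2 - t4 + 1)./2.*2 + t4 = t2 + 1,
      (t2 + t4 - 1)./2.*2 + 1 = t2 + t4
    & (t1 + t3 + 1)./2.*2 = t1 + t3 + 1 /\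
      (t1 - t3 - 1)./2.*2 + t3 + 1 = t1].
Proof.
case: m => [|[|[|[|k]]]] // _.
have -> : (Posz k.+4 - 1)%R = Posz k.+3 by lia.
have -> : (Posz k.+4 - 2)%R = Posz k.+2 by lia.
have -> : (Posz k.+4 - 3)%R = Posz k.+1 by lia.
have -> : (Posz k.+4 - 4)%R = Posz k by lia.
rewrite /=.
have H : [/\ odd (t k.+2 + t k), odd (t k.+3 + t k.+1),
    t k.+3 <= 5 * t k.+1 + 1, 3 * t k.+1 + 1 <= t k.+3
  & t k < t k.+2].
  elim: k => [|k [h1 h2 h3 h4 h5]]; first by [].
  have [b1 b2 b3 b4] := t_bounds k; have [_ b5 b6 b7] := t_bounds k.+1.
  move: h2 h3 h4; rewrite !t_rec => h2 h3 h4.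
  by split; lia.
case: H; move: (t k) (t k.+1) (t k.+2) (t k.+3) => a b c d h1 h2 h3 h4 h5.
split; [lia|lia|lia|lia|split; lia].
Qed.

Lemma Theta_exact (m : nat) :
  (t (m%:Z + 1)%R + t (m%:Z - 1)%R - 3)./2.*2 + 3
    = t (m%:Z + 1)%R + t (m%:Z - 1)%R.
Proof.
case: m => [|k]; first by [].
have -> : (Posz k.+1 + 1)%R = Posz k.+2 by lia.
have -> : (Posz k.+1 - 1)%R = Posz k by lia.
have [H _] : odd (t k.+2 + t k) /\ odd (t k.+3 + t k.+1).
  by elim: k => [|k [h1]]; rewrite // !t_rec => h2; split; lia.
have [b1 b2 b3 _] := t_bounds k.
by move: (t k) (t k.+1) (t k.+2) H b1 b2 b3 => a b c *; lia.
Qed.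

Lemma is_level_uniq n M M' : is_level n M -> is_level n M' -> M = M'.
Proof.
have aux N N' : N < N' -> is_level n N -> is_level n N' -> False.
  case: N' => // N' leN /andP[_ /andP[_ h]] /andP[_ /andP[h' _]].
  move: h'; have -> : (Posz N'.+1 - 1)%R = Posz N' by lia.
  by have := t_mono (leN : N <= N'); lia.
by move=> h h'; case: (ltngtP M M') => // /aux; [move/(_ h h')|move/(_ h' h)].
Qed.

Lemma levelP n : 15 <= n ->
  is_level n (level n) /\ forall M, is_level n M -> M = level n.
Proof.
move=> n15.
have ex : exists M : nat, n <= 2 * t M by exists n; have := t_gt n; lia.
case: (ex_minnP ex) => M hM minM.
have M0 : 0 < M.
  by case: M hM {minM} => // h; move: (leq_trans n15 h).
have lM : is_level n M.
  rewrite /is_level M0 hM andbT /=.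
  have -> : (Posz M - 1)%R = Posz M.-1 by lia.
  by rewrite ltnNge; apply/negP => /minM; lia.
have Mn : M < n.
  have [|] := leqP M n.-1; first by lia.
  by have := t_gt n.-1; move=> h /ltnW h'; have := minM n.-1; lia.
have hs : has (is_level n) (iota 0 n) by apply/hasP; exists M; rewrite ?mem_iota.
have l : is_level n (level n).
  by have := nth_find 0 hs; rewrite nth_iota // -[X in _ < X](size_iota 0 n) -has_find.
by split=> // M' h; apply: is_level_uniq h l.
Qed.

Lemma is_tribonacci_exists_unique :
  exists w, is_tribonacci w /\ forall w', is_tribonacci w' -> w' =1 w.
Proof.
have presig u v : prefix u v -> prefix (sigma u) (sigma v).
  by move=> /prefixP [s ->]; rewrite sigma_cat prefix_prefix.
have chain (j d : nat) : prefix (Tword j) (Tword (j + d)%N).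
  rewrite addnC; elim: d => [|d IH]; first exact: prefix_refl.
  rewrite addSn; apply: prefix_trans IH _.
  by elim: (d + j) => // e IHe; apply: presig IHe.
pose w (i : nat) := nth La (Tword i) i.
have wE (k i : nat) : i < t k -> nth La (Tword k) i = w i.
  move=> hi; case: (leqP k i) => [|/ltnW] /subnKC.
    move=> e; have /prefixP[s] := chain k (i - k); rewrite e /w => ->.
    by rewrite nth_cat ifT.
  move=> e; have /prefixP[s] := chain i (k - i); rewrite e /w => ->.
  by rewrite nth_cat ifT // -/(t i) t_gt.
have prefE (k n : nat) : n <= t k -> pref w n = take n (Tword k).
  move=> le; apply: (@eq_from_nth _ La); first by rewrite size_mkseq size_takel.
  move=> i; rewrite size_mkseq => hi.
  by rewrite nth_mkseq // nth_take // wE //; apply: leq_trans le.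
exists w; split.
  split=> // n.
  have hn : n <= t n by apply: ltnW (t_gt n).
  have: prefix (sigma (pref w n)) (Tword n.+1).
    rewrite (prefE n n hn); apply: presig.
    by apply/prefixP; exists (drop n (Tword n)); rewrite cat_take_drop.
  move=> hp; have := size_prefix hp => hs.
  rewrite [RHS](prefE n.+1) //.
  by move: hp; rewrite prefixE => /eqP.
move=> w' [w0 fw].
have T' (k : nat) : Tword k = pref w' (t k).
  elim: k => [|k IH]; first by change ([:: La] = [:: w' 0]); rewrite w0.
  by have := fw (t k); rewrite -IH.
by move=> i; rewrite /w T' nth_mkseq // t_gt.
Qed.

(* Main.v *)
(* A run of period l (w i = w (i + l) on an interval [s, e)) that is extended
   maximally to the left starts with the letter a as soon as e > s, so it
   is the sigma-image of a shorter run; iterating, every square lies in the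
   image under sigma^j of an empty run of period 1, i.e. its period is
   |sigma^j(w p)| and it lies in the run starting at |sigma^j(w[1,p])|, along
   which the two copies agree with the prefix of w of length
   S_j = t_0 + ... + t_(j-1).  As w shifted by t_m agrees with w on its first
   S_m letters, for S_(m-3) < k <= S_m the squares ending at k + t_m are those
   ending at k and the ones too long to end at k.  By the classification the
   latter have period t_(m-3), t_(m-2) + t_(m-3) or t_m, for
   k < 2 t_(m-3), t_(m-2) + t_(m-3) <= k <= S_(m-1) and t_m <= k respectively:
   these are the three blocks of ones of the algorithm. *)
Require Import Defs.
From mathcomp Require Import all_boot all_order all_algebra.
From mathcomp Require Import classical_sets cardinality.
From mathcomp Require Import zify.

Set Implicit Arguments.
Unset Strict Implicit.
Unset Printing Implicit Defensive.

Local Open Scope nat_scope.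

(** * Block positions, run lengths, and squares given by end and period *)

Definition sigma_pos (w : nat -> letter) (n : nat) : nat :=
  size (sigma (pref w n)).

(** The last letter of [sigma1 x], and also the second letter of [sigma1 x] followed by a. Its
    injectivity recovers a letter from its block. *)
Definition next_letter (x : letter) : letter :=
  match x with La => Lb | Lb => Lc | Lc => La end.

Lemma next_letter_inj : injective next_letter.
Proof. by case; case. Qed.

(* Equal to t_0 + ... + t_(j-1), cf. [run_lengthS], so that Theta_j starts at
   position [run_length w j + 1]. *)
Fixpoint run_length (w : nat -> letter) (j : nat) : nat :=
  if j is j'.+1 then (sigma_pos w (run_length w j')).+1 else 0.

(* The position k is 1-based, and l = 0 satisfies the predicate. *)
Definition square_end (w : nat -> letter) (k l : nat) : bool :=
  (2 * l <= k) && all (fun i => w (k - 2 * l + i) == w (k - l + i)) (iota 0 l).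

Definition squares_at (w : nat -> letter) (k : nat) : nat :=
  count (square_end w k) (iota 1 k).

Lemma eq_squares_at (w1 w2 : nat -> letter) k :
  (forall i, i < k -> w1 i = w2 i) -> squares_at w1 k = squares_at w2 k.
Proof.
move=> h; apply: eq_in_count => l; rewrite mem_iota /square_end => hl.
case: leqP => //= lk; apply: eq_in_all => i; rewrite mem_iota => hi.
by rewrite !h //; lia.
Qed.

(** * Cutting the Tribonacci word into sigma-blocks *)

Section Desubstitution.

Variable w : nat -> letter.
Hypothesis wT : is_tribonacci w.

Local Notation f := (sigma_pos w).
Local Notation F j := (iter j f).
Local Notation S := (run_length w).

Lemma pref_rcons n : pref w n.+1 = rcons (pref w n) (w n).
Proof. by rewrite /pref mkseqS. Qed.

Lemma sigma_pos0 : f 0 = 0. Proof. by []. Qed.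

Lemma sigma_posS n : f n.+1 = f n + (w n != Lc).+1.
Proof.
rewrite /sigma_pos pref_rcons -cats1 sigma_cat size_cat; congr (_ + _).
by case: (w n).
Qed.

Lemma nth_sigma n i : i < (w n != Lc).+1 ->
  w (f n + i) = nth La (sigma1 (w n)) i.
Proof.
move=> hi; have [_ fp] := wT; have := fp n.+1; rewrite -/(f n.+1).
move=> /(congr1 (fun s => nth La s (f n + i))).
rewrite nth_mkseq; last by rewrite sigma_posS ltn_add2l.
rewrite pref_rcons -cats1 sigma_cat nth_cat -/(f n) ltnNge leq_addr /=.
by rewrite addKn => <-; rewrite /sigma /= cats0.
Qed.

Lemma at_sigma_pos n : w (f n) = La.
Proof. by rewrite -[f n]addn0 nth_sigma //; case: (w n). Qed.

Lemma after_sigma_pos n : w (f n).+1 = next_letter (w n).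
Proof.
case e: (w n); last first.
  by have := at_sigma_pos n.+1; rewrite sigma_posS e addn1 => ->.
all: by rewrite -addn1 nth_sigma e.
Qed.

Lemma before_sigma_pos n : w (f n.+1).-1 = next_letter (w n).
Proof.
rewrite sigma_posS; case e: (w n); rewrite /= ?addn1 ?addn2 /=.
- by rewrite after_sigma_pos e.
- by rewrite after_sigma_pos e.
- by rewrite at_sigma_pos.
Qed.

Lemma sigma_pos_ltS n : f n < f n.+1.
Proof. by rewrite sigma_posS; lia. Qed.

Lemma sigma_pos_homo : {homo f : m n / m < n}.
Proof. exact: homo_ltn ltn_trans sigma_pos_ltS. Qed.

Lemma sigma_pos_lt m n : (f m < f n) = (m < n).
Proof. exact: (leqW_mono (leq_mono sigma_pos_homo)). Qed.

Lemma sigma_pos_le m n : (f m <= f n) = (m <= n).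
Proof. exact: (leq_mono sigma_pos_homo). Qed.

Lemma leq_sigma_pos n : n <= f n.
Proof. by elim: n => // n IH; exact: leq_ltn_trans IH (sigma_pos_ltS n). Qed.

Lemma sigma_block i : exists n,
  i = f n \/ i = (f n).+1 /\ w n <> Lc.
Proof.
elim: i => [|i [n [->|[-> h]]]]; first by exists 0; left.
  case e: (w n).
  - by exists n; right; rewrite e.
  - by exists n; right; rewrite e.
  - by exists n.+1; left; rewrite sigma_posS e addn1.
exists n.+1; left; rewrite sigma_posS.
by case: (w n) h => // _; rewrite addn2.
Qed.

Lemma La_sigma_pos i : w i = La -> exists n, i = f n.
Proof.
move=> wi; have [n [->|[e h]]] := sigma_block i; first by exists n.
by move: wi; rewrite e after_sigma_pos; case: (w n) h.
Qed.

Lemma La_after i : w i <> La -> w i.+1 = La.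
Proof.
have [n [->|[-> h]]] := sigma_block i; first by rewrite at_sigma_pos.
move=> _; have := at_sigma_pos n.+1; rewrite sigma_posS.
by case: (w n) h => // _; rewrite addn2.
Qed.

Lemma La_before i : w i.+1 <> La -> w i = La.
Proof. by case: (w i =P La) => // h; rewrite La_after. Qed.

(** Of two consecutive letters one is a, and its block has two letters. *)
Lemma sigma_posSS n : f n + 3 <= f n.+2.
Proof.
rewrite !sigma_posS; case e: (w n) => /=; try lia.
by have -> : w n.+1 = La; [apply: La_after; rewrite e | rewrite /=; lia].
Qed.

(** * Images of equal factors *)

Lemma match_sigma_pos p q L : (forall i, i < L -> w (p + i) = w (q + i)) ->
  forall i, i <= L -> f (p + i) + f q = f (q + i) + f p.
Proof.
move=> h; elim=> [|i IH] hi; first by rewrite !addn0 addnC.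
by rewrite !addnS !sigma_posS (h i hi); have := IH (ltnW hi); lia.
Qed.

(** The range includes the letter just past both images: it opens the next block, so it is a. *)
Lemma match_sigma p q L : (forall i, i < L -> w (p + i) = w (q + i)) ->
  forall i, f p + i <= f (p + L) -> w (f p + i) = w (f q + i).
Proof.
move=> h i hi.
have : exists2 n, n <= L & f p + i = f (p + n) \/
   [/\ n < L & f p + i = (f (p + n)).+1].
  have [n [e|[e hn]]] := sigma_block (f p + i).
    have pn : p <= n by rewrite -sigma_pos_le -e leq_addr.
    exists (n - p); first by rewrite -(leq_add2l p) subnKC // -sigma_pos_le -e.
    by left; rewrite subnKC.
  have fn : f n.+1 = (f n).+2.
    by rewrite sigma_posS; case: (w n) hn => // _; rewrite addn2.
  have pn : p <= n by rewrite -ltnS -sigma_pos_lt; lia.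
  have nL : n - p < L.
    by rewrite -(ltn_add2l p) subnKC // -sigma_pos_lt; lia.
  by exists (n - p); [lia | right; rewrite subnKC].
move=> [n nL [e|[ltn e]]].
  have e2 := match_sigma_pos h nL.
  have -> : f q + i = f (q + n) by lia.
  by rewrite e !at_sigma_pos.
have e2 := match_sigma_pos h nL.
have -> : f q + i = (f (q + n)).+1 by lia.
by rewrite e !after_sigma_pos h.
Qed.

(** * Iterates of sigma and the lengths of runs *)

Lemma iter_sigma_pos_lt j : {mono F j : m n / m < n}.
Proof. by elim: j => // j IH m n; rewrite !iterS sigma_pos_lt IH. Qed.

Lemma iter_sigma_pos_le j : {mono F j : m n / m <= n}.
Proof. by elim: j => // j IH m n; rewrite !iterS sigma_pos_le IH. Qed.

Lemma iter_sigma_pos0 j : F j 0 = 0.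
Proof. by elim: j => // j IH; rewrite iterS IH. Qed.

(* Images of distinct letters start with the letter [a], which is why a common
   run grows by one letter at each application of sigma. *)
Lemma run_prefix j s : forall i, i < S j -> w (F j s + i) = w i.
Proof.
elim: j => [|j IH] // i /=; rewrite ltnS => hi.
have h : forall i, i < S j -> w (0 + i) = w (F j s + i) by move=> k /IH.
by have := match_sigma h (i := i); rewrite sigma_pos0 => /(_ hi).
Qed.

Lemma sigma_pos_run j s : f (F j s + S j) = F j.+1 s + f (S j).
Proof.
have h : forall i, i < S j -> w (F j s + i) = w (0 + i) by exact: run_prefix.
have := match_sigma_pos h (leqnn _).
by rewrite sigma_pos0 addn0 => ->; rewrite addnC.
Qed.

Lemma iter_sigma_posD j p L : (forall i, i < L -> w (p + i) = w i) ->
  F j (p + L) = F j p + F j L.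
Proof.
elim: j p L => // j IH p L h; rewrite !iterSr -IH.
  have h' : forall i, i < L -> w (p + i) = w (0 + i) by [].
  have := match_sigma_pos h' (leqnn _).
  by rewrite sigma_pos0 addn0 => ->; rewrite addnC.
move=> i hi; have h' : forall i, i < L -> w (0 + i) = w (p + i) by move=> k /h.
by rewrite -(match_sigma h') // ltnW.
Qed.

Lemma sigma_iterE j n : iter j sigma (pref w n) = pref w (F j n).
Proof.
by elim: j => // j IH; rewrite !iterS IH; have [_ ->] := wT.
Qed.

Lemma iter_sigma_pos1 j : F j 1 = t j.
Proof.
have [w0 _] := wT.
have e : pref w 1 = [:: La] by rewrite /pref /mkseq /= w0.
by rewrite /t /= -e sigma_iterE size_mkseq.
Qed.

(** At s = 1, [sigma_pos_run] reads f (t_j + S_j) = t_(j+1) + f (S_j), where f (S_i) = S_(i+1) -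
    1. *)
Lemma run_lengthS j : S j.+1 = S j + t j.
Proof.
elim: j => // j IH; have := sigma_pos_run j 1.
rewrite !iter_sigma_pos1 addnC -IH -[f (S j.+1)]/(S j.+2).-1.
by rewrite -[f (S j)]/(S j.+1).-1 /=; lia.
Qed.

(** Identifies [S j.+1] with the offset in the definition of Theta_(j+1). *)
Lemma run_lengthE j : 2 * S j.+1 + 3 = t j.+2 + t j.
Proof. by elim: j => // j IH; rewrite run_lengthS t_rec; lia. Qed.

(** * Classification of runs and squares *)

(** Strong induction on the end e. The bound allows a run one letter short of a square; this slack
    survives desubstitution, down to the empty run, where it forces l = 1. *)
Lemma run_classification e s l :
    0 < l -> s <= e -> s + l <= e.+1 ->
    (forall i, s <= i < e -> w i = w (i + l)) ->
    (0 < s -> w s.-1 <> w (s.-1 + l)) ->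
  exists j p, [/\ s = F j p, F j p + l = F j p.+1 & e <= s + S j].
Proof.
elim/ltn_ind: e s l => e IH s l l0 se sle hrun hleft.
case: (ltngtP s e) se => // [lt_se _|es _]; last first.
  by exists 0, s; split=> //=; lia.
(* Were w s not a, the equal letters at s and s + l would both be preceded by a, against maximality
   to the left. *)
have ws : w s = La.
  case: (posnP s) => [->|s0]; first by case: wT.
  have hs := hrun s; rewrite leqnn lt_se in hs; have {}hs := hs isT.
  case: (w s =P La) => // ns; case: (hleft s0).
  have -> : w s.-1 = La by apply: La_before; rewrite prednK.
  by rewrite La_before // -addSn prednK // -hs.
have wsl : w (s + l) = La by rewrite -hrun // leqnn.
have [s' es] := La_sigma_pos ws; have [r er] := La_sigma_pos wsl.
have s'r : s' < r by rewrite -sigma_pos_lt; lia.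
(* Block e' is the first one whose second position [(f e').+1] is not before e. *)
have [e' [s'e' e'e hlow hup]] : exists e',
    [/\ s' <= e', e' < e, (forall i, i < e' -> (f i).+1 < e) & e <= (f e').+1].
  have [n [en|[en hn]]] := sigma_block e.-1.
    exists n; split; last lia.
    - by rewrite -sigma_pos_le; lia.
    - by have := leq_sigma_pos n; lia.
    - by move=> i hi; have := sigma_pos_homo hi; lia.
  have fn : f n.+1 = (f n).+2.
    by rewrite sigma_posS; case: (w n) hn => // _; rewrite addn2.
  exists n.+1; split; last lia.
  - by apply: ltnW; rewrite -sigma_pos_lt; lia.
  - by have := leq_sigma_pos n; lia.
  - by move=> i; rewrite ltnS -sigma_pos_le; lia.
(* Second positions inside the run determine the block letters, by [next_letter_inj]. *)
have hmatch d : s' + d <= e' -> f (r + d) = f (s' + d) + l /\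
    forall i, i < d -> w (s' + i) = w (r + i).
  elim: d => [|d IHd] hd; first by rewrite !addn0 -er -es.
  have [h1 h2] := IHd ltac:(lia).
  have eq_d : w (s' + d) = w (r + d).
    apply: next_letter_inj; rewrite -!after_sigma_pos h1 -addSn; apply: hrun.
    have := hlow (s' + d) ltac:(lia) => ->; rewrite andbT es leqW //.
    by rewrite sigma_pos_le leq_addr.
  split; first by rewrite !addnS !sigma_posS -eq_d h1; lia.
  by move=> i; rewrite ltnS leq_eqVlt => /predU1P [->|/h2].
have [| | | |j [p [e1 e2 e3]]] := IH e' e'e s' (r - s') _ s'e'.
- lia.
(* Two consecutive blocks have at least three letters, which preserves the slack. *)
- have : f r < f e'.+2 by have := sigma_posSS e'; lia.
  by rewrite sigma_pos_lt; lia.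
- move=> i /andP[i1 i2]; have [_] := hmatch (e' - s') ltac:(lia).
  by move=> /(_ (i - s') ltac:(lia)); rewrite subnKC // => ->; congr w; lia.
(* The last letter of a block depends only on its source letter, so maximality to the left
   descends. *)
- move=> s'0; have s0 : 0 < s by rewrite es; apply: leq_trans (leq_sigma_pos _).
  move: (hleft s0); have -> : s.-1 + l = (s + l).-1 by lia.
  have -> : s'.-1 + (r - s') = r.-1 by lia.
  have := before_sigma_pos s'.-1; have := before_sigma_pos r.-1.
  rewrite !prednK ?(leq_trans _ s'r) // er es => -> ->.
  by move=> ne eq_w; apply: ne; rewrite eq_w.
exists j.+1, p; split.
- by rewrite iterS -e1.
- by rewrite !iterS -e2 -e1 subnKC 1?ltnW // -es.
- apply: leq_trans hup _; rewrite es e1 addnS ltnS.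
  by have := sigma_pos_run j p; rewrite iterS => <-; rewrite sigma_pos_le -e1.
Qed.

(** Extend the run of the square to the left as far as possible and classify it. Conversely, by
    [run_prefix], both halves copy the same stretch of the first S j letters. *)
Lemma square_endP k l : 0 < l -> reflect
  (exists j p, [/\ F j p + l = F j p.+1, F j p + 2 * l <= k
                 & k <= F j p + S j + l])
  (square_end w k l).
Proof.
move=> l0; apply: (iffP idP) => [/andP[kl /allP sq]|[j [p [e1 e2 e3]]]].
  have : forall i, k - 2 * l <= i < k - l -> w i = w (i + l).
    move=> i hi; have := sq (i - (k - 2 * l)).
    rewrite mem_iota => /(_ ltac:(lia)) /eqP; rewrite subnKC; last by lia.
    by move=> ->; congr w; lia.
  have : k - 2 * l <= k - 2 * l by [].
  (* The induction moves the start of the run left until the copies disagree or the word begins. *)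
  elim: {1 3}(k - 2 * l) => [|s IH] sk hs.
    have [|||j [p [e1 e2 e3]]] := @run_classification (k - l) 0 l l0 _ _ hs.
    - by [].
    - by lia.
    - by [].
    by exists j, p; split=> //; lia.
  case: (w s =P w (s + l)) => [es|ns].
    apply: IH => [|i /andP[i1 i2]]; first exact: ltnW.
    move: i1; rewrite leq_eqVlt => /predU1P[<- //|i1].
    by apply: hs; rewrite i1.
  have [||_|j [p [e1 e2 e3]]] := @run_classification (k - l) s.+1 l l0 _ _ hs.
  - by lia.
  - by lia.
  - by [].
  by exists j, p; split=> //; lia.
rewrite /square_end; apply/andP; split; first by lia.
apply/allP => i; rewrite mem_iota => hi; apply/eqP.
have x0 : k - 2 * l - F j p + i < S j by lia.
have -> : k - 2 * l + i = F j p + (k - 2 * l - F j p + i) by lia.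
have -> : k - l + i = F j p.+1 + (k - 2 * l - F j p + i) by lia.
by rewrite !run_prefix.
Qed.

(** * Bounds on run lengths, and images of the first four letters *)

Lemma run_length_mono i j : i <= j -> S i <= S j.
Proof.
move=> /subnK <-; elim: (j - i) => // d IH.
by rewrite addSn run_lengthS (leq_trans IH) ?leq_addr.
Qed.

Lemma t_leq_run_length (j : nat) : t j <= (S j).+1.
Proof.
case: j => [|[|[|j]]] //; last by rewrite t_rec !run_lengthS; lia.
by rewrite run_lengthS.
Qed.

Lemma letter0 : w 0 = La.
Proof. by case: wT. Qed.

Lemma letter1 : w 1 = Lb.
Proof. by have := after_sigma_pos 0; rewrite letter0. Qed.

Lemma sigma_pos1 : f 1 = 2.
Proof. by rewrite sigma_posS letter0. Qed.

Lemma sigma_pos2 : f 2 = 4.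
Proof. by rewrite sigma_posS sigma_pos1 letter1. Qed.

Lemma iter_sigma_pos2 j : F j 2 = t j.+1.
Proof. by rewrite -iter_sigma_pos1 iterSr sigma_pos1. Qed.

Lemma iter_sigma_pos3 j : F j 3 = t j.+1 + t j.
Proof.
rewrite -[3]/(2 + 1) iter_sigma_posD ?iter_sigma_pos1 ?iter_sigma_pos2 //.
case=> // _; rewrite letter0.
by have := at_sigma_pos 1; rewrite sigma_pos1.
Qed.

Lemma iter_sigma_pos4 j : F j 4 = t j.+2.
Proof. by rewrite -iter_sigma_pos2 iterSr sigma_pos2. Qed.

(** * Squares after a shift by t_m *)

Lemma square_end_shift m k l : k <= S m -> 2 * l <= k ->
  square_end w (k + t m) l = square_end w k l.
Proof.
move=> km lk; rewrite /square_end lk; have -> /= : 2 * l <= k + t m by lia.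
apply: eq_in_all => i; rewrite mem_iota => hi.
(* The first S m letters recur from position [F m 1] = t_m on. *)
have -> : k + t m - 2 * l + i = F m 1 + (k - 2 * l + i).
  by rewrite iter_sigma_pos1; lia.
have -> : k + t m - l + i = F m 1 + (k - l + i) by rewrite iter_sigma_pos1; lia.
by rewrite !run_prefix; lia.
Qed.

(** With m = n + 4, the three periods are the lengths of sigma^(m-2)(c), sigma^(m-1)(b) and
    sigma^m(a). *)
Definition new_square (n k l : nat) : bool :=
  [|| (l == t n.+1) && (k < 2 * t n.+1),
      (l == t n.+2 + t n.+1) && (t n.+2 + t n.+1 <= k <= S n.+3)
    | (l == t n.+4) && (t n.+4 <= k)].

Lemma square_end_new n k l : S n.+1 < k <= S n.+4 -> 0 < l -> k < 2 * l ->
  square_end w (k + t n.+4) l = new_square n k l.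
Proof.
move=> /andP[k1 k2] l0 kl.
have r3 := t_rec n; have r4 := t_rec n.+1.
have [b1 b2 b3 b4] := t_bounds n.
have [_ b5 b6 b7] := t_bounds n.+1.
have [_ b8 b9 b10] := t_bounds n.+2.
have [_ b11 b12 b13] := t_bounds n.+3.
have s1 := run_lengthS n.+1; have s2 := run_lengthS n.+2.
have s3 := run_lengthS n.+3; have s4 := run_lengthS n.+4.
have S1 := run_lengthE n; have tS := t_leq_run_length n.+1.
apply/idP/idP => [/(square_endP _ l0) [j [p [e1 e2 e3]]]|].
  have ltF : F j p < t n.+4 by lia.
  (* As t_m = [F j (F (m - j) 1)] for m = n + 4, a block starting before t_m ends by t_m; then k <=
     S j <= S n.+1, a contradiction. *)
  case: (leqP j n.+1) => [jn|nj].
    have pt : p < F (n.+4 - j) 1.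
      rewrite -(iter_sigma_pos_lt j) -iterD subnKC ?iter_sigma_pos1 //.
      by lia.
    move: pt; rewrite -(iter_sigma_pos_le j) -iterD subnKC ?iter_sigma_pos1.
      by have := run_length_mono jn; lia.
    by lia.
  case: (ltngtP j n.+4) => [jn|nj'|ej].
  (* For these j, only the block ending exactly at t_m leaves k > S n.+1. *)
  - have [ej|ej] : j = n.+2 \/ j = n.+3 by lia.
      subst j; have p4 : p < 4.
        by rewrite -(iter_sigma_pos_lt n.+2) iter_sigma_pos4.
      case: p p4 e1 e2 e3 ltF => [|[|[|[|//]]]] _.
      + by rewrite iter_sigma_pos0 iter_sigma_pos1; lia.
      + by rewrite iter_sigma_pos1 iter_sigma_pos2; lia.
      + by rewrite iter_sigma_pos2 iter_sigma_pos3; lia.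
      + rewrite iter_sigma_pos3 iter_sigma_pos4 => e1 e2 e3 _.
        by apply/or3P; apply: Or31; lia.
    subst j; have p2 : p < 2.
      by rewrite -(iter_sigma_pos_lt n.+3) iter_sigma_pos2.
    case: p p2 e1 e2 e3 ltF => [|[|//]] _.
    + by rewrite iter_sigma_pos0 iter_sigma_pos1; lia.
    + rewrite iter_sigma_pos1 iter_sigma_pos2 => e1 e2 e3 _.
      by apply/or3P; apply: Or32; lia.
  (* Only p = 0 starts early enough, but then 2 t_j > k + t_m. *)
  - have tj : t n.+4 < t j.
      by apply: leq_trans (t_mono nj'); case: (t_bounds n.+4).
    case: p e1 e2 e3 ltF => [|p]; last first.
      have : F j 1 <= F j p.+1 by rewrite iter_sigma_pos_le.
      by rewrite iter_sigma_pos1; lia.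
    rewrite iter_sigma_pos0 iter_sigma_pos1 => e1 e2 e3 _.
    have := t_mono nj'; have := run_lengthE n.+4; have := t_bounds n.+4.
    by case; lia.
  - subst j; case: p e1 e2 e3 ltF => [|p]; last first.
      have : F n.+4 1 <= F n.+4 p.+1 by rewrite iter_sigma_pos_le.
      by rewrite iter_sigma_pos1; lia.
    rewrite iter_sigma_pos0 iter_sigma_pos1 => e1 e2 e3 _.
    by apply/or3P; apply: Or33; lia.
case/or3P => /andP[/eqP el hk]; apply/(square_endP _ l0).
- exists n.+2, 3; rewrite iter_sigma_pos3 iter_sigma_pos4; split; lia.
- exists n.+3, 1; rewrite iter_sigma_pos1 iter_sigma_pos2; split; lia.
- exists n.+4, 0; rewrite iter_sigma_pos0 iter_sigma_pos1; split; lia.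
Qed.

Definition correction (n k : nat) : bool :=
  [|| k < 2 * t n.+1, t n.+2 + t n.+1 <= k <= S n.+3 | t n.+4 <= k].

(** The ranges of k in [correction] are disjoint, so at most one period is new. The count starts at
    [k./2.+1], the shortest period too long for a square ending at k. *)
Lemma count_new_square n k : S n.+1 < k <= S n.+4 ->
  count (new_square n k) (iota k./2.+1 (k + t n.+4 - k./2)) = correction n k.
Proof.
move=> /andP[k1 k2].
have r3 := t_rec n; have r4 := t_rec n.+1.
have [b1 b2 b3 b4] := t_bounds n.
have [_ b5 b6 b7] := t_bounds n.+1.
have [_ b8 b9 b10] := t_bounds n.+2.
have S1 := run_lengthE n.+2; have S2 := run_lengthE n.+3.
have [_ b11 b12 b13] := t_bounds n.+3.
pose x := if k < 2 * t n.+1 then t n.+1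
          else if k <= S n.+3 then t n.+2 + t n.+1 else t n.+4.
have E l : new_square n k l = correction n k && (l == x).
  rewrite /new_square /correction /x.
  case: (ltnP k (2 * t n.+1)) => h1; first by lia.
  by case: (leqP k (S n.+3)) => h2; lia.
rewrite (eq_count E) /correction.
case h: (correction n k); last by rewrite -/(correction n k) h count_pred0.
rewrite -/(correction n k) h count_uniq_mem ?iota_uniq // mem_iota.
move: h; rewrite /correction /x.
case: (ltnP k (2 * t n.+1)) => h1 /=; first by lia.
by case: (leqP k (S n.+3)) => h2 /=; lia.
Qed.

Lemma squares_at_shift n k : S n.+1 < k <= S n.+4 ->
  squares_at w (k + t n.+4) = squares_at w k + correction n k.
Proof.
move=> hk; rewrite -(count_new_square hk) /squares_at.
have split_iota K : k./2 <= K ->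
    iota 1 K = iota 1 k./2 ++ iota k./2.+1 (K - k./2).
  by move=> h; rewrite -{2}add1n -iotaD subnKC.
rewrite (split_iota k) ?(split_iota (k + _)); try lia.
rewrite !count_cat -addnA.
have -> : count (square_end w k) (iota k./2.+1 (k - k./2)) = 0.
  rewrite -(count_pred0 (iota k./2.+1 (k - k./2))).
  apply: eq_in_count => l; rewrite mem_iota /square_end => hl /=.
  by case: leqP => //; lia.
congr (_ + _); apply: eq_in_count => l; rewrite mem_iota => hl.
  by rewrite square_end_shift; lia.
by apply: square_end_new; lia.
Qed.

(** * The vector of the algorithm *)

Lemma TwordE (j : nat) : Tword j = pref w (t j).
Proof.
by rewrite -iter_sigma_pos1 -sigma_iterE /pref /mkseq /= letter0.
Qed.

Lemma squares_at_v0 : map (squares_at w) (iota 1 14) = v0.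
Proof.
(* A concrete word of t_5 = 24 letters makes the first 14 entries computable. *)
pose w' i := nth La (Tword 5) i.
have ww' i : i < 14 -> w i = w' i.
  by move=> hi; rewrite /w' TwordE nth_mkseq //; apply: leq_trans hi _.
transitivity (map (squares_at w') (iota 1 14)); last by vm_compute.
apply/eq_in_map => k; rewrite mem_iota => hk.
by apply: eq_squares_at => i hi; apply: ww'; lia.
Qed.

Lemma ThetaE (j : nat) : Theta j.+1 = iota (S j.+1).+1 (t j.+1).
Proof.
rewrite /Theta -[(S j.+1).+1]addn1 iotaDl.
apply: eq_map => i; rewrite addnC; congr (_ + _).
have := run_lengthE j.
have -> : (Posz j.+1 + 1)%R = Posz j.+2 by lia.
have -> : (Posz j.+1 - 1)%R = Posz j by lia.
by lia.
Qed.

Lemma restrict_ThetaE (b : nat -> nat) L (j : nat) a c x y :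
    S j.+2 <= L -> a + c = t j.+1 ->
  vadd (restrict (map b (iota 1 L)) (Theta j.+1)) (nseq a x ++ nseq c y) =
  [seq b i + (if i <= S j.+1 + a then x else y)
     | i <- iota (S j.+1).+1 (t j.+1)].
Proof.
rewrite run_lengthS ThetaE => hL ac; move: (S j.+1) hL => s hL.
have size_eq : size (restrict (map b (iota 1 L)) (iota s.+1 (t j.+1))) =
    size (nseq a x ++ nseq c y).
  by rewrite size_map size_cat !size_nseq size_iota.
apply: (@eq_from_nth _ 0) => [|i].
  by rewrite !size_map size1_zip ?size_eq // -size_eq size_map.
rewrite size_map size1_zip ?size_eq // -size_eq size_map size_iota => hi.
rewrite (nth_map (0, 0)); last first.
  by rewrite size1_zip ?size_eq // -size_eq size_map size_iota.
rewrite nth_zip //=.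
rewrite (nth_map 0) ?size_iota // (nth_map 0) ?size_iota // !nth_iota //.
rewrite (nth_map 0) ?size_iota; last by lia.
rewrite nth_iota; last by lia.
rewrite add1n; congr (_ + _).
rewrite nth_cat size_nseq !nth_nseq addSn ltn_add2l.
case: (ltnP i a) => // h; rewrite ifT //.
lia.
Qed.

(** With m = n + 4, S_m = S_(m-3) + t_m, so the shift by t_m carries Theta_(m-3), Theta_(m-2),
    Theta_(m-1) onto the positions S_m + 1, ..., S_(m+1). *)
Lemma stepE n : step (map (squares_at w) (iota 1 (S n.+4))) n.+4 =
  map (squares_at w) (iota 1 (S n.+4.+1)).
Proof.
have r3 := t_rec n; have r4 := t_rec n.+1.
have e1 : (Posz n.+4 - 1)%R = Posz n.+3 by lia.
have e2 : (Posz n.+4 - 2)%R = Posz n.+2 by lia.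
have e3 : (Posz n.+4 - 3)%R = Posz n.+1 by lia.
have e4 : (Posz n.+4 - 4)%R = Posz n by lia.
have [] := @correction_exact n.+4 isT.
rewrite /step e1 e2 e3 e4 => c1 c2 c3 c4 [c5 c6].
have [b1 b2 b3 b4] := t_bounds n.
have [_ b5 b6 b7] := t_bounds n.+1.
have [_ b8 b9 b10] := t_bounds n.+2.
have S0 := run_lengthE n; have S1 := run_lengthE n.+1.
have S2 := run_lengthE n.+2; have S3 := run_lengthE n.+3.
have s1 := run_lengthS n.+1; have s2 := run_lengthS n.+2.
have s3 := run_lengthS n.+3; have s4 := run_lengthS n.+4.
have piece j a x y : S n.+1 <= S j -> S j.+1 <= S n.+4 ->
    (forall k, S j < k <= S j.+1 ->
       correction n k = (if k <= S j + a then x else y) :> nat) ->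
    [seq squares_at w i + (if i <= S j + a then x else y)
       | i <- iota (S j).+1 (t j)]
      = map (squares_at w) (iota (t n.+4 + (S j).+1) (t j)).
  move=> h1 h2 hc; rewrite [in RHS]iotaDl -map_comp; apply/eq_in_map => k.
  rewrite mem_iota addSn ltnS -run_lengthS => /andP[k1 k2] /=.
  rewrite -hc ?k1 // [t n.+4 + k]addnC squares_at_shift //.
  by rewrite (leq_ltn_trans h1 k1) (leq_trans k2 h2).
rewrite !restrict_ThetaE; try by lia.
(* The thresholds S j + a are 2 t_(m-3) - 1, t_(m-2) + t_(m-3) - 1 and t_m - 1, those of
   [correction]. *)
rewrite !piece; try by [lia | move=> k hk; rewrite /correction; case: ifP; lia].
rewrite -!map_cat; congr map.
have -> : S n.+4.+1 = S n.+4 + (t n.+1 + (t n.+2 + t n.+3)) by lia.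
by rewrite !iotaD; congr (_ ++ (iota _ _ ++ (iota _ _ ++ iota _ _))); lia.
Qed.

Lemma vecE M : 3 <= M -> vec M = map (squares_at w) (iota 1 (S M.+1)).
Proof.
move=> /subnK <-; rewrite /vec addnK.
elim: (M - 3) => [|d IH].
  (* S 4 = 1 + 2 + 4 + 7 = 14, the length of [v0]. *)
  by rewrite -squares_at_v0 !run_lengthS.
rewrite -(addn1 d) iotaD foldl_cat IH [foldl _ _ _]/=.
have -> : d + 3 = d.+3 by lia.
have -> : d + 1 + 3 = d.+4 by lia.
exact: stepE.
Qed.

Lemma algorithmE n : algorithm n = \sum_(1 <= k < n.+1) squares_at w k.
Proof.
rewrite /algorithm.
have take_iota L : n <= L ->
    sumn (take n (map (squares_at w) (iota 1 L))) =
      \sum_(1 <= k < n.+1) squares_at w k.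
  move=> hn; rewrite -map_take take_iota (minn_idPl hn) sumnE big_map.
  by rewrite /index_iota subn1.
case: (leqP n 14) => hn; first by rewrite -squares_at_v0 take_iota.
have [/andP[M0 /andP[_ nM]] _] := levelP hn.
have M3 : 3 < level n.
  (* Otherwise n <= 2 t_3 = 14. *)
  by rewrite ltnNge; apply/negP => /t_mono; rewrite -[t 3]/7; lia.
rewrite vecE ?take_iota 1?ltnW //.
(* The vector has at least n entries: n <= 2 t_M <= S_(M+1). *)
case: (level n) M3 nM => [|[|[|[|m]]]] // _ nM.
have := run_lengthE m.+4; have := t_rec m.+3; have := t_rec m.+2.
have := t_rec m.+1; have := t_rec m.
have := t_bounds m => -[]; lia.
Qed.

End Desubstitution.

(** * From squares to pairs of a word and an occurrence number *)

Definition last_letters (w : nat -> letter) (k l : nat) : seq letter :=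
  mkseq (fun i => w (k - l + i)) l.

Lemma pref_cat w k l : l <= k ->
  pref w k = pref w (k - l) ++ last_letters w k l.
Proof.
move=> lk; rewrite /pref /last_letters /mkseq -{1}(subnK lk) iotaD map_cat.
by rewrite add0n -[X in iota X l]addn0 iotaDl -map_comp.
Qed.

Lemma suffix_pref w k om :
  suffix om (pref w k) =
    (size om <= k) && (om == last_letters w k (size om)).
Proof.
case: leqP => [h|h]; last first.
  by apply: contraTF h => /size_suffix; rewrite size_mkseq leqNgt.
rewrite suffixE size_mkseq (pref_cat w h) drop_size_cat ?size_mkseq //.
Qed.

Lemma square_endE w k l :
  square_end w k l =
    (2 * l <= k) && (last_letters w (k - l) l == last_letters w k l).
Proof.
rewrite /square_end; case: leqP => //= lk; rewrite /last_letters.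
have -> : k - l - l = k - 2 * l by lia.
apply/allP/eqP => [h|/eq_in_map h i /h /eqP //].
by apply/eq_in_map => i /h /eqP.
Qed.

Lemma suffix_square w k om :
  suffix (om ++ om) (pref w k) =
    suffix om (pref w k) && square_end w k (size om).
Proof.
rewrite !suffix_pref square_endE size_cat addnn -mul2n.
case: (leqP (2 * size om) k) => h; last by rewrite andbF.
have -> : size om <= k by lia.
have -> : last_letters w k (2 * size om) =
    last_letters w (k - size om) (size om) ++ last_letters w k (size om).
  move: (pref_cat w h); rewrite (@pref_cat w k (size om)); last by lia.
  rewrite (@pref_cat w (k - size om) (size om)); last by lia.
  have -> : k - size om - size om = k - 2 * size om by lia.
  by rewrite -catA => /eqP; rewrite eqseq_cat // => /andP[_ /eqP].
rewrite eqseq_cat ?size_mkseq //.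
move: (last_letters w k _) (last_letters w (k - _) _) => B A /=.
by case: (om =P B) => [->|_]; rewrite ?andbF //= andbT eq_sym.
Qed.

Definition occurrences (w : nat -> letter) (om : seq letter) (k : nat) : nat :=
  count (fun j => suffix om (pref w j)) (iota 1 k).

Lemma occurrences_lt w om k k' : k < k' -> suffix om (pref w k') ->
  occurrences w om k < occurrences w om k'.
Proof.
move=> kk' suf; rewrite /occurrences.
rewrite -[in iota 1 k'](subnKC (ltnW kk')) iotaD count_cat.
rewrite -addn1 leq_add2l -has_count.
by apply/hasP; exists k' => //; rewrite mem_iota; lia.
Qed.

(** The right half of a square is occurrence p + 1 of its word, whence [.-1]. *)
Definition square_pairs (w : nat -> letter) (n : nat) :
    seq (seq letter * nat) :=
  [seq (last_letters w k l, (occurrences w (last_letters w k l) k).-1)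
     | k <- iota 1 n, l <- filter (square_end w k) (iota 1 k)].

Lemma size_square_pairs w n :
  size (square_pairs w n) = \sum_(1 <= k < n.+1) squares_at w k.
Proof.
rewrite size_allpairs_dep sumnE big_map /index_iota subn1.
by apply: eq_bigr => k _; rewrite size_filter.
Qed.

Lemma suffix_last_letters w k l : l <= k ->
  suffix (last_letters w k l) (pref w k).
Proof. by move=> lk; rewrite suffix_pref size_mkseq lk eqxx. Qed.

Lemma occurrences_gt0 w om k : 0 < k -> suffix om (pref w k) ->
  0 < occurrences w om k.
Proof. by move=> k0 /(occurrences_lt k0); exact: leq_trans. Qed.

(** The word gives l; the count of its occurrences grows strictly along their ends, so it gives
    k. *)
Lemma square_pairs_uniq w n : uniq (square_pairs w n).
Proof.
apply: allpairs_uniq_dep; first exact: iota_uniq.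
  by move=> k _; rewrite filter_uniq ?iota_uniq.
move=> x y /allpairsPdep [k [l [kn lk ->]]].
move=> /allpairsPdep [k' [l' [kn' lk' ->]]] /=; move: kn kn' lk lk'.
rewrite !mem_filter !mem_iota => kn kn' lk lk' [e1 e2].
have el : l = l' by move/(congr1 size): e1; rewrite !size_mkseq.
subst l'; have k0 : 0 < k by lia.
have k'0 : 0 < k' by lia.
have suf : suffix (last_letters w k l) (pref w k).
  by apply: suffix_last_letters; lia.
have suf' : suffix (last_letters w k l) (pref w k').
  by rewrite e1; apply: suffix_last_letters; lia.
have := occurrences_gt0 k0 suf; have := occurrences_gt0 k'0 suf'.
move: e2; rewrite -e1 => e2 g1 g2.
suff -> : k = k' by [].
case: (ltngtP k k') => // /occurrences_lt lt_occ.
  by have := lt_occ _ _ suf'; lia.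
by have := lt_occ _ _ suf; lia.
Qed.

Lemma repeated_squaresE w n x :
  repeated_squares w n x <-> x \in square_pairs w n.
Proof.
case: x => om p; split=> [[/= om0 _ p1 [k [[suf cnt] + kn]]]|].
  rewrite suffix_square suf /= => sq.
  have l0 : 0 < size om by case: (om) om0.
  have lk : 2 * size om <= k by case/andP: sq.
  move: suf; rewrite suffix_pref => /andP[_ /eqP eom].
  apply/allpairsPdep; exists k, (size om).
  rewrite mem_filter sq !mem_iota -eom /occurrences cnt; split=> //; lia.
case/allpairsPdep => k [l []]; rewrite mem_filter !mem_iota.
move=> kn /andP[sq hl] [-> ->].
have lk : 2 * l <= k by case/andP: sq.
have suf : suffix (last_letters w k l) (pref w k).
  by apply: suffix_last_letters; lia.
(* The left half is an earlier occurrence, hence p >= 1. *)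
have occ2 : 1 < occurrences w (last_letters w k l) k.
  apply: leq_trans (@occurrences_lt _ _ (k - l) _ _ suf); last by lia.
  move: sq; rewrite square_endE => /andP[_ /eqP <-]; rewrite ltnS.
  by apply: occurrences_gt0; [lia | apply: suffix_last_letters; lia].
split=> /=.
- by move/(congr1 size); rewrite size_mkseq /=; lia.
- by exists k.
- by lia.
- exists k; split; last by lia.
    by split=> //; rewrite -/(occurrences _ _ _) prednK // ltnW.
  by rewrite suffix_square suf size_mkseq.
Qed.

Theorem mainTheorem3 (w : nat -> letter) (n : nat) :
  is_tribonacci w -> (1 <= n)%N ->
  (repeated_squares w n #= `I_(algorithm n))%card.
Proof.
move=> wT _; rewrite (algorithmE wT) -size_square_pairs.
set s := square_pairs w n.
(* Indexing the duplicate-free list [s] is the required bijection. *)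
have <- : (nth ([::], 0) s @` `I_(size s))%classic = repeated_squares w n.
  apply/seteqP; split=> x.
    by case=> i hi <-; apply/repeated_squaresE/mem_nth.
  by move=> /repeated_squaresE /(nthP ([::], 0)) [i hi <-]; exists i.
apply: inj_card_eq => i j /set_mem /= hi /set_mem /= hj /eqP.
by rewrite nth_uniq ?square_pairs_uniq // => /eqP.
Qed.
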